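(* Let $\mathfrak{X}$ be a saturated fusion action system of a finite $p$-group $S$ acting on a finite set $X$. Then every morphism of $\mathfrak{X}$ can be written as a composite of restrictions of automorphisms of subgroups of $S$ and inclusions. Explicitly: for all $P,Q\le S$ and $(\varphi,\sigma)\in\mathfrak{X}(P,Q)$ there are an integer $n\ge 0$, subgroups $P=P_0,P_1,\dots,P_n=\varphi(P)$ of $S$, subgroups $R_1,\dots,R_n\le S$ with $P_{i-1},P_i\le R_i$, and automorphisms $(\varphi_i,\sigma_i)\in\mathfrak{X}(R_i)$ with $\varphi_i(P_{i-1})=P_i$ for $1\le i\le n$, such that $\sigma=\sigma_n\cdots\sigma_1$ and $\varphi$ equals $\varphi_n|_{P_{n-1}}\circ\cdots\circ\varphi_1|_{P_0}$ followed by the inclusion $\varphi(P)\le Q$.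
   Context: Let $p$ be a prime, $S$ a finite $p$-group, and $X$ a finite set with a left $S$-action; $\Sigma_X$ is the symmetric group on $X$, $\ell_s\in\Sigma_X$ is the permutation $x\mapsto s\cdot x$, and $c_s$ is conjugation $h\mapsto shs^{-1}$. $\mathrm{Inj}(P,Q)$ is the set of injective homomorphisms $P\to Q$. A pair $(\varphi,\sigma)\in\mathrm{Inj}(P,Q)\times\Sigma_X$ ($P,Q\le S$) is intertwined if $\sigma\ell_p\sigma^{-1}=\ell_{\varphi(p)}$ for all $p\in P$. Let $\mathfrak{U}$ be the category whose objects are all subgroups of $S$, whose morphisms $P\to Q$ are the intertwined pairs, composed componentwise. Let $\mathfrak{X}_S\subseteq\mathfrak{U}$ have the same objects and morphisms $P\to Q$ the pairs $(c_s|_P,\ell_s)$ with $s\in S$, $sPs^{-1}\le Q$. A fusion action system of $S$ on $X$ is a category $\mathfrak{X}$ with $\mathfrak{X}_S\subseteq\mathfrak{X}\subseteq\mathfrak{U}$ such that every morphism of $\mathfrak{X}$ factors as an isomorphism of $\mathfrak{X}$ followed by an inclusion $(\mathrm{incl},\mathrm{id}_X)$. Write $\mathfrak{X}(P)=\mathfrak{X}(P,P)$ and $\mathfrak{X}(P,Q)_{\mathrm{iso}}$ for the isomorphisms. The underlying fusion system $\mathcal{F}^{\mathfrak{X}}$ has the subgroups of $S$ as objects and $\mathcal{F}^{\mathfrak{X}}(P,Q)=\{\varphi : \exists\sigma,\ (\varphi,\sigma)\in\mathfrak{X}(P,Q)\}$; two subgroups are conjugate if they are isomorphic in $\mathcal{F}^{\mathfrak{X}}$.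 Let $C=\{s\in S:\ell_s=\mathrm{id}_X\}$, $N_S(P;X)=N_S(P)\cap C$, $Z_S(P;X)=Z_S(P)\cap C$. A subgroup $P\le S$ is fully normalized (resp. fully centralized, fully $X$-normalized, fully $X$-centralized) if $|N_S(P)|\ge|N_S(Q)|$ (resp. the same inequality for $Z_S(-)$, $N_S(-;X)$, $Z_S(-;X)$) for all $Q$ conjugate to $P$. Put $\mathrm{Aut}_S(P)=\{c_s|_P:s\in N_S(P)\}$, $\mathrm{Aut}_S(P;X)=\{(c_s|_P,\ell_s):s\in N_S(P)\}$, $\Sigma_{\mathfrak{X}}(P)=\{\sigma:\exists\varphi,(\varphi,\sigma)\in\mathfrak{X}(P)\}$, $\Sigma^S_{\mathfrak{X}}(P)=\{\ell_s:s\in N_S(P)\}$, $\mathcal{F}^{\mathfrak{X}}(P)_0=\{\varphi:(\varphi,\mathrm{id}_X)\in\mathfrak{X}(P)\}$, $\mathcal{F}_S(P)_0=\{c_s|_P:s\in N_S(P;X)\}$, $\Sigma_{\mathfrak{X}}(P)_0=\{\sigma:(\mathrm{id}_P,\sigma)\in\mathfrak{X}(P)\}$, $\Sigma^S_{\mathfrak{X}}(P)_0=\{\ell_s:s\in Z_S(P)\}$. The extender of $(\varphi,\sigma)\in\mathfrak{X}(P,Q)_{\mathrm{iso}}$ is $N_{(\varphi,\sigma)}=\{n\in N_S(P):(\varphi c_n\varphi^{-1},\sigma\ell_n\sigma^{-1})\in\mathrm{Aut}_S(Q;X)\}$. $\mathfrak{X}$ is saturated if: (1) for every $P\le S$, fully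 normalized implies fully $X$-normalized and fully centralized, and each of fully $X$-normalized and fully centralized implies fully $X$-centralized; (2) if $P$ is fully normalized then $\mathrm{Aut}_S(P)\in\mathrm{Syl}_p(\mathcal{F}^{\mathfrak{X}}(P))$, $\mathrm{Aut}_S(P;X)\in\mathrm{Syl}_p(\mathfrak{X}(P))$ and $\Sigma^S_{\mathfrak{X}}(P)\in\mathrm{Syl}_p(\Sigma_{\mathfrak{X}}(P))$; (3) if $P$ is fully $X$-normalized then $\mathcal{F}_S(P)_0\in\mathrm{Syl}_p(\mathcal{F}^{\mathfrak{X}}(P)_0)$; (4) if $P$ is fully centralized then $\Sigma^S_{\mathfrak{X}}(P)_0\in\mathrm{Syl}_p(\Sigma_{\mathfrak{X}}(P)_0)$; (5) if $Q$ is fully $X$-centralized and $(\varphi,\sigma)\in\mathfrak{X}(P,Q)_{\mathrm{iso}}$, there is $(\widetilde\varphi,\sigma)\in\mathfrak{X}(N_{(\varphi,\sigma)},S)$ with $\widetilde\varphi|_P=\varphi$. *)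

(* Defs.v *)
From HB Require Import structures.
From mathcomp Require Import all_boot all_fingroup pgroup.

Set Implicit Arguments.
Unset Strict Implicit.
Unset Printing Implicit Defensive.

Local Open Scope group_scope.

(** The finite p-group is the whole of a [finGroupType] [S], so its subgroups
    are the elements of [{group S}]; in particular [N_S(P)] is ['N(P)] and
    [Z_S(P)], the centralizer of [P] in [S], is ['C(P)].

    The library composes permutations from left to right: for [{perm X}],
    [sigma * tau] is "first [sigma], then [tau]", so the functional composite
    of [tau] after [sigma] is [sigma * tau], and the functional conjugate of
    [a] by [sigma] (inverse of [sigma] first, then [a], then [sigma]) is
    [a ^ sigma]. *)

Record left_action (S : finGroupType) (X : finType) := LeftAction {
  lact :> S -> X -> X;
  lact1 : forall x, lact 1 x = x;
  lactM : forall s t x, lact (s * t) x = lact s (lact t x)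
}.

Section LeftAction.

Variables (S : finGroupType) (X : finType) (l : left_action S X).

Lemma lact_inj (s : S) : injective (l s).
Proof.
by apply: (can_inj (g := l s^-1)) => x; rewrite -lactM mulVg lact1.
Qed.

Definition ell (s : S) : {perm X} := perm (@lact_inj s).

Definition act_kernel : {set S} := [set s | ell s == 1].

End LeftAction.

Definition lconj (S : finGroupType) (s h : S) : S := s * h * s^-1.

Definition inj_hom (S : finGroupType) (P Q : {group S}) (phi : S -> S) : Prop :=
  [/\ {in P &, {morph phi : x y / x * y}},
      {in P &, injective phi}
    & phi @: P \subset Q].

Definition intertwined (S : finGroupType) (X : finType) (l : left_action S X)
    (P Q : {group S}) (phi : S -> S) (sigma : {perm X}) : Prop :=
  inj_hom P Q phi /\ {in P, forall q, ell l q ^ sigma = ell l (phi q)}.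

(** A hom-family [H] is viewed as a category on the subgroups of [S]. A map
    with source [P] is represented by any function on [S] with the prescribed
    values on [P]; values outside [P] are irrelevant. *)
Definition hom_family (S : finGroupType) (X : finType) : Type :=
  {group S} -> {group S} -> (S -> S) -> {perm X} -> bool.

Definition is_fas_iso (S : finGroupType) (X : finType) (H : hom_family S X)
    (P Q : {group S}) (phi : S -> S) (sigma : {perm X}) : Prop :=
  H P Q phi sigma /\
  exists psi tau,
    [/\ H Q P psi tau,
        {in P, cancel phi psi}, {in Q, cancel psi phi},
        sigma * tau = 1 & tau * sigma = 1].

(** Identities and inclusions need no separate axiom: the inclusion of [P] in
    [Q] is [id] with the trivial permutation, and agrees on [P] with [lconj 1]
    and [ell l 1]. *)
Record fusion_action_system (S : finGroupType) (X : finType)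
    (l : left_action S X) := FusionActionSystem {
  fas_hom : hom_family S X;
  fas_ext : forall (P Q : {group S}) (phi psi : S -> S) (sigma : {perm X}),
    {in P, phi =1 psi} -> fas_hom P Q phi sigma = fas_hom P Q psi sigma;
  fas_comp : forall (P Q R : {group S}) (phi psi : S -> S)
      (sigma tau : {perm X}),
    fas_hom P Q phi sigma -> fas_hom Q R psi tau ->
    fas_hom P R (psi \o phi) (sigma * tau);
  fas_intertwined : forall (P Q : {group S}) (phi : S -> S) (sigma : {perm X}),
    fas_hom P Q phi sigma -> intertwined l P Q phi sigma;
  fas_lconj : forall (P Q : {group S}) (s : S),
    lconj s @: P \subset Q -> fas_hom P Q (lconj s) (ell l s);
  fas_factor : forall (P Q : {group S}) (phi : S -> S) (sigma : {perm X}),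
    fas_hom P Q phi sigma ->
    exists (R : {group S}) (psi : S -> S) (tau : {perm X}),
      [/\ R \subset Q, is_fas_iso fas_hom P R psi tau,
          {in P, phi =1 id \o psi} & sigma = tau * 1]
}.

Section FusionActionSystem.

Variables (S : finGroupType) (X : finType) (l : left_action S X).
Variable (XX : fusion_action_system l).
Implicit Types (P Q : {group S}) (phi : S -> S) (sigma : {perm X}).

Definition fusion_hom P Q phi : Prop := exists sigma, fas_hom XX P Q phi sigma.

Definition fas_conjugate P Q : Prop :=
  exists phi psi,
    [/\ fusion_hom P Q phi, fusion_hom Q P psi,
        {in P, cancel phi psi} & {in Q, cancel psi phi}].

Definition normalizerX (P : {set S}) : {set S} := 'N(P) :&: act_kernel l.
Definition centralizerX (P : {set S}) : {set S} := 'C(P) :&: act_kernel l.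

Definition fully_normalized P : Prop :=
  forall Q, fas_conjugate P Q -> #|'N(Q)| <= #|'N(P)|.
Definition fully_centralized P : Prop :=
  forall Q, fas_conjugate P Q -> #|'C(Q)| <= #|'C(P)|.
Definition fully_Xnormalized P : Prop :=
  forall Q, fas_conjugate P Q -> #|normalizerX Q| <= #|normalizerX P|.
Definition fully_Xcentralized P : Prop :=
  forall Q, fas_conjugate P Q -> #|centralizerX Q| <= #|centralizerX P|.

(** Automorphisms of [P] are represented, as in [Aut P], by permutations of
    [S] fixing every element outside [P]. Since permutations are multiplied
    from left to right, the groups below carry the opposite of the composition
    law, which affects neither subgroups, nor orders, nor Sylow subgroups. *)
Definition aut_fas P : {set {perm S} * {perm X}} :=
  [set a | (a.1 \in Aut P) && fas_hom XX P P a.1 a.2].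
Definition aut_fusion P : {set {perm S}} := [set a.1 | a in aut_fas P].
Definition Sigma_fas P : {set {perm X}} := [set a.2 | a in aut_fas P].
Definition aut_fusion0 P : {set {perm S}} :=
  [set phi | (phi, 1) \in aut_fas P].
Definition Sigma_fas0 P : {set {perm X}} :=
  [set sigma | (1, sigma) \in aut_fas P].

(** [conj_aut P t] is the restriction of [h |-> t^-1 * h * t], hence the
    inverse. *)
Definition lconj_aut P (s : S) : {perm S} := conj_aut P s^-1.

Definition AutS P : {set {perm S}} := [set lconj_aut P s | s in 'N(P)].
Definition AutSX P : {set {perm S} * {perm X}} :=
  [set (lconj_aut P s, ell l s) | s in 'N(P)].
Definition SigmaS P : {set {perm X}} := [set ell l s | s in 'N(P)].
Definition AutS0 P : {set {perm S}} := [set lconj_aut P s | s in normalizerX P].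
Definition SigmaS0 P : {set {perm X}} := [set ell l s | s in 'C(P)].

(** The inverse of an injection on [P]; arbitrary outside its image. *)
Definition inv_on P phi (y : S) : S := odflt 1 [pick x in P | phi x == y].

Definition extender P Q phi sigma : {set S} :=
  [set n in 'N(P) | [exists a in AutSX Q,
     [forall y in Q, a.1 y == phi (lconj n (inv_on P phi y))]
     && (a.2 == ell l n ^ sigma)]].

(** For an isomorphism [(phi, sigma)] from [P] to [Q] the extender is a
    subgroup of [S], so the generated group in [sat_extension] is the extender
    itself. *)
Record saturated (p : nat) : Prop := Saturated {
  sat_fully_normalized : forall P, fully_normalized P ->
    fully_Xnormalized P /\ fully_centralized P;
  sat_fully_Xnormalized : forall P, fully_Xnormalized P -> fully_Xcentralized P;
  sat_fully_centralized : forall P, fully_centralized P -> fully_Xcentralized P;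
  sat_Sylow : forall P, fully_normalized P ->
    [/\ p.-Sylow(aut_fusion P) (AutS P),
        p.-Sylow(aut_fas P) (AutSX P)
      & p.-Sylow(Sigma_fas P) (SigmaS P)];
  sat_Sylow_aut0 : forall P, fully_Xnormalized P ->
    p.-Sylow(aut_fusion0 P) (AutS0 P);
  sat_Sylow_Sigma0 : forall P, fully_centralized P ->
    p.-Sylow(Sigma_fas0 P) (SigmaS0 P);
  sat_extension : forall P Q phi sigma, fully_Xcentralized Q ->
    is_fas_iso (fas_hom XX) P Q phi sigma ->
    exists2 phi' : S -> S,
      fas_hom XX <<extender P Q phi sigma>>%G [set: S]%G phi' sigma
      & {in P, phi' =1 phi}
}.

End FusionActionSystem.

(** [f n \o ... \o f 1] *)
Fixpoint comp_upto (T : Type) (f : nat -> T -> T) (n : nat) : T -> T :=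
  if n is m.+1 then f m.+1 \o comp_upto f m else id.

(* Main.v *)
Require Import Defs.
From HB Require Import structures.
From mathcomp Require Import all_boot all_fingroup pgroup.
From mathcomp Require Import sylow nilpotent.

(** This is Alperin's fusion theorem, and it is proved by descending induction
    on the order of the source. Call an isomorphism [(phi, sigma)] decomposable
    if it is a composite of restrictions of automorphisms. Decomposable
    isomorphisms compose ([decomposable_comp]), are invertible
    ([decomposable_inv], because an injective endomorphism of a finite subgroup
    is an automorphism) and restrict to smaller subgroups
    ([decomposable_restrict]).

    Let [(phi, sigma)] be an isomorphism from [P] to [Q] with [P] proper, and
    let [R] be a fully normalized conjugate of both. The main point
    ([extends_to_normalizer]) is that some isomorphism from [P] to [R] extends
    to the whole of the normalizer of [P]: transported along an isomorphism,
    the automorphisms of [P] induced by [S] form a p-subgroup of the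
    automorphism group of [R], and since those of [R] induced by [S] form a
    Sylow p-subgroup there, an automorphism of [R] corrects the isomorphism so
    that the former land among the latter. Then the extender is everything
    that it can be, and the extension axiom applies because a fully normalized
    subgroup is fully X-centralized.

    A proper subgroup of a p-group is smaller than its normalizer, so by
    induction this extension, hence its restriction [P -> R], is decomposable;
    the same holds for some isomorphism [Q -> R]. Along these two, [phi]
    becomes an automorphism of [R], so [phi] is decomposable. *)

Set Implicit Arguments.
Unset Strict Implicit.
Unset Printing Implicit Defensive.

Local Open Scope group_scope.

(** * Permutations and the action *)

(** Adding one point [x] to the domain costs one transposition: composing with
    the exchange of [s x] and [f x] corrects the value at [x] and, by
    injectivity of [f], touches no earlier value. Isomorphisms between subgroups
    of [S] can thus be represented by permutations of [S], so that transporting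
    automorphisms along them is conjugation in one ambient group. *)
Lemma perm_extending (T : finType) (A : {set T}) (f : T -> T) :
  {in A &, injective f} -> exists s : {perm T}, {in A, s =1 f}.
Proof.
have [n] := ubnP #|A|; elim: n A => // n IHn A ltAn injf.
have [->|[x Ax]] := set_0Vmem A; first by exists 1 => x; rewrite inE.
have [||s sE] := IHn (A :\ x).
- by rewrite (cardsD1 x) Ax in ltAn.
- by move=> y z /setD1P[_ Ay] /setD1P[_ Az]; apply: injf.
exists (s * tperm (s x) (f x)) => y Ay; rewrite permM.
have [->|ne_yx] := eqVneq y x; first by rewrite tpermL.
have Ay' : y \in A :\ x by rewrite !inE ne_yx.
rewrite -(sE y Ay') tpermD ?(inj_eq perm_inj) 1?eq_sym // sE //.
by apply: contra_neq ne_yx; apply: injf.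
Qed.

Section Action.

Variables (S : finGroupType) (X : finType) (l : left_action S X).

Lemma ellM (s t : S) : ell l (s * t) = ell l t * ell l s.
Proof. by apply/permP=> x; rewrite permM !permE lactM. Qed.

Lemma ell1 : ell l 1 = 1.
Proof. by apply/permP=> x; rewrite !permE lact1. Qed.

(** [s |-> (lconj_aut P s, ell l s)] reverses products, since permutations are
    multiplied from left to right; precomposing with inversion makes it a
    homomorphism. *)
Definition inv_autSX (P : {group S}) (s : S) : {perm S} * {perm X} :=
  (conj_aut P s, ell l s^-1).

Lemma inv_autSX_morphM (P : {group S}) :
  {in 'N(P) &, {morph inv_autSX P : s t / s * t}}.
Proof.
move=> s t Ns Nt; rewrite /inv_autSX invMg ellM conj_aut_morphM //.
Qed.

Canonical inv_autSX_morphism (P : {group S}) := Morphism (@inv_autSX_morphM P).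

Lemma AutSX_morphim (P : {group S}) : AutSX l P = inv_autSX P @* 'N(P).
Proof.
rewrite morphimEdom; apply/setP=> a; apply/imsetP/imsetP=> -[s Ns ->].
  by exists s^-1; rewrite ?groupV //= /inv_autSX invgK.
by exists s^-1; rewrite ?groupV //= /inv_autSX /lconj_aut invgK.
Qed.

Lemma AutSX_group_set (P : {group S}) : group_set (AutSX l P).
Proof. by rewrite AutSX_morphim groupP. Qed.

Canonical AutSX_group (P : {group S}) := Group (AutSX_group_set P).

Lemma AutSX_pgroup (p : nat) (P : {group S}) :
  p.-group [set: S] -> p.-group (AutSX l P).
Proof.
move=> pS; rewrite AutSX_morphim morphim_pgroup //.
exact: pgroupS (subsetT _) pS.
Qed.

Lemma lconj_autE (P : {group S}) (s x : S) :
  s \in 'N(P) -> x \in P -> lconj_aut P s x = lconj s x.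
Proof.
move=> Ns Px; rewrite /lconj_aut norm_conj_autE ?groupV //.
by rewrite conjgE invgK /lconj mulgA.
Qed.

End Action.

Section FusionActionSystem.

Variables (S : finGroupType) (X : finType) (l : left_action S X).
Variable (XX : fusion_action_system l).
Implicit Types (P Q R : {group S}) (phi psi : S -> S) (sigma tau : {perm X}).

Local Notation is_iso := (is_fas_iso (fas_hom XX)).

(** * Isomorphisms of a fusion action system *)

Lemma fas_hom_inj P Q phi sigma :
  fas_hom XX P Q phi sigma -> {in P &, injective phi}.
Proof. by move/fas_intertwined=> [[]]. Qed.

Lemma fas_hom_sub P Q phi sigma :
  fas_hom XX P Q phi sigma -> phi @: P \subset Q.
Proof. by move/fas_intertwined=> [[]]. Qed.

Lemma fas_hom_morph P Q phi sigma :
  fas_hom XX P Q phi sigma -> {in P &, {morph phi : x y / x * y}}.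
Proof. by move/fas_intertwined=> [[]]. Qed.

Lemma fas_incl P Q : P \subset Q -> fas_hom XX P Q id 1.
Proof.
move=> sPQ; have lconj1: lconj (1 : S) =1 id.
  by move=> x; rewrite /lconj mul1g invg1 mulg1.
rewrite -(ell1 l) -(fas_ext XX _ _ (phi := lconj 1)); last by move=> x _.
by apply: fas_lconj; rewrite (eq_imset _ lconj1) imset_id.
Qed.

Lemma fas_restrict P Q R phi sigma :
  P \subset Q -> fas_hom XX Q R phi sigma -> fas_hom XX P R phi sigma.
Proof. by move=> /fas_incl/fas_comp/[apply]; rewrite mul1g. Qed.

Lemma fas_iso_image P Q phi sigma : is_iso P Q phi sigma -> phi @: P = Q.
Proof.
case=> hom [psi [tau [/fas_hom_sub/subsetP im_psi _ psiK _ _]]].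
apply/eqP; rewrite eqEsubset (fas_hom_sub hom); apply/subsetP=> y Qy.
by apply/imsetP; exists (psi y); rewrite ?psiK // im_psi ?imset_f.
Qed.

(** The isomorphism in a factorization of [phi] has the values of [phi], so its
    target can only be the image of [phi]; in particular images are groups. *)
Lemma fas_corestrict P Q phi sigma : fas_hom XX P Q phi sigma ->
  exists2 R : {group S}, R = phi @: P :> {set S} & is_iso P R phi sigma.
Proof.
case/fas_factor=> R [psi [tau [_ isoR phiE ->]]]; rewrite mulg1.
have imR := fas_iso_image isoR; exists R.
  by rewrite -imR; apply/eq_in_imset=> x /phiE.
case: isoR => hom [chi [rho [homV psiK chiK tauK rhoK]]].
split; first by rewrite (fas_ext XX _ _ phiE).
exists chi, rho; split=> // [x Px|y Ry]; first by rewrite phiE // psiK.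
rewrite phiE /= ?chiK //.
by apply: (subsetP (fas_hom_sub homV)); rewrite imset_f.
Qed.

(** The factorization axiom makes every surjective morphism invertible within
    the system. *)
Lemma fas_isoP P Q phi sigma :
  is_iso P Q phi sigma <-> fas_hom XX P Q phi sigma /\ phi @: P = Q.
Proof.
split=> [iso|[/fas_corestrict[R imR iso] imQ]].
  by split; [case: iso | apply: fas_iso_image iso].
by have <- : R = Q by apply: val_inj; rewrite /= imR.
Qed.

Lemma fas_iso_inv P Q phi sigma : is_iso P Q phi sigma ->
  exists psi, [/\ is_iso Q P psi sigma^-1, {in P, cancel phi psi}
                & {in Q, cancel psi phi}].
Proof.
move=> iso; case: (iso) => hom [psi [tau [homV phiK psiK tauK rhoK]]].
have <- : tau = sigma^-1 by apply: (mulgI sigma); rewrite tauK mulgV.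
by exists psi; split=> //; split=> //; exists phi, sigma.
Qed.

Lemma fas_iso_comp P Q R phi psi sigma tau :
  is_iso P Q phi sigma -> is_iso Q R psi tau ->
  is_iso P R (psi \o phi) (sigma * tau).
Proof.
move=> /fas_isoP[hom1 im1] /fas_isoP[hom2 im2]; apply/fas_isoP.
by split; [apply: fas_comp hom1 hom2 | rewrite imset_comp im1].
Qed.

Lemma fas_iso_ext P Q phi psi sigma : {in P, phi =1 psi} ->
  is_iso P Q phi sigma -> is_iso P Q psi sigma.
Proof.
move=> eq_phi /fas_isoP[hom im]; apply/fas_isoP.
split; first by rewrite -(fas_ext XX _ _ eq_phi).
by rewrite -im; apply/eq_in_imset=> x /eq_phi.
Qed.

Lemma fas_iso_card P Q phi sigma : is_iso P Q phi sigma -> #|P| = #|Q|.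
Proof.
by move=> /fas_isoP[hom <-]; rewrite card_in_imset //; apply: fas_hom_inj hom.
Qed.

(** Conjugacy in the underlying fusion system does not relate the permutations
    attached to the two mutually inverse maps; yet surjectivity of one of them
    already gives an isomorphism of the action system. *)
Lemma fas_conjugateP P Q :
  fas_conjugate XX P Q <-> exists phi sigma, is_iso P Q phi sigma.
Proof.
split=> [[phi [psi [[sigma hom] [tau homV] phiK psiK]]]|].
  exists phi, sigma; apply/fas_isoP; split=> //.
  apply/eqP; rewrite eqEsubset (fas_hom_sub hom); apply/subsetP=> y Qy.
  apply/imsetP; exists (psi y); rewrite ?psiK //.
  by apply: (subsetP (fas_hom_sub homV)); rewrite imset_f.
case=> phi [sigma iso]; have [psi [isoV phiK psiK]] := fas_iso_inv iso.
exists phi, psi; split=> //; first by exists sigma; case: iso.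
by exists sigma^-1; case: isoV.
Qed.

(** Conjugacy is decidable, as only the finitely many functions on [S] matter;
    so the order of the normalizer can be maximized over a conjugacy class. *)
Definition fas_conjugateb P Q : bool :=
  [exists phi : {ffun S -> S}, exists sigma : {perm X},
     fas_hom XX P Q phi sigma && (phi @: P == Q)].

Lemma fas_conjugatebP P Q :
  reflect (exists phi sigma, is_iso P Q phi sigma) (fas_conjugateb P Q).
Proof.
apply: (iffP existsP) => [[phi /existsP[sigma /andP[hom /eqP im]]]|].
  by exists phi, sigma; apply/fas_isoP.
case=> phi [sigma iso]; exists (finfun phi); apply/existsP; exists sigma.
have /fas_isoP[-> ->] : is_iso P Q (finfun phi) sigma; last by rewrite eqxx.
by apply: fas_iso_ext iso => x _; rewrite ffunE.
Qed.

Lemma exists_fully_normalized P :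
  exists R phi sigma, fully_normalized XX R /\ is_iso P R phi sigma.
Proof.
have conjPP : fas_conjugateb P P.
  apply/fas_conjugatebP; exists id, 1; apply/fas_isoP.
  by rewrite imset_id; split=> //; apply: fas_incl.
case: (arg_maxnP (fun Q : {group S} => #|'N(Q)|) conjPP).
move=> R /fas_conjugatebP[phi [sigma iso]] maxR.
exists R, phi, sigma; split=> // Q /fas_conjugateP[psi [tau iso']].
apply: maxR; apply/fas_conjugatebP.
by exists (psi \o phi), (sigma * tau); apply: fas_iso_comp iso iso'.
Qed.

(** * Extension to normalizers *)

Lemma in_aut_fas P a :
  (a \in aut_fas XX P) = (a.1 \in Aut P) && fas_hom XX P P a.1 a.2.
Proof. by rewrite inE. Qed.

Lemma aut_fas_group_set P : group_set (aut_fas XX P).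
Proof.
apply/group_setP; split=> [|[a u] [b v]].
  rewrite in_aut_fas group1 /= (fas_ext XX _ _ (psi := id)) ?fas_incl //.
  by move=> x _; rewrite perm1.
rewrite !in_aut_fas /= => /andP[Aa hom_a] /andP[Ab hom_b]; rewrite groupM //=.
rewrite (fas_ext XX _ _ (psi := b \o a)); last by move=> x _; rewrite permM.
exact: fas_comp hom_a hom_b.
Qed.

Canonical aut_fas_group P := Group (aut_fas_group_set P).

Lemma AutSX_sub P : AutSX l P \subset aut_fas XX P.
Proof.
apply/subsetP=> _ /imsetP[s Ns ->]; rewrite in_aut_fas /=.
have Aut_s : lconj_aut P s \in Aut P by rewrite Aut_aut.
rewrite Aut_s (fas_ext XX _ _ (psi := lconj s)).
  apply: fas_lconj; apply/subsetP=> _ /imsetP[x Px ->].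
  by rewrite -(lconj_autE Ns) // Aut_closed.
by move=> x Px; rewrite lconj_autE.
Qed.

Lemma aut_fas_conj P R (r : {perm S}) tau a :
  is_iso P R r tau -> a \in aut_fas XX P -> a ^ (r, tau) \in aut_fas XX R.
Proof.
case: a => a u iso; rewrite !in_aut_fas /= => /andP[Aut_a hom_a].
have [psi [isoV rK psiK]] := fas_iso_inv iso.
have imR := fas_iso_image iso.
have PrV y : y \in R -> r^-1 y \in P.
  by rewrite -imR => /imsetP[x Px ->]; rewrite permK.
have homV : fas_hom XX R P r^-1 tau^-1.
  case: isoV => homV _; rewrite (fas_ext XX _ _ (psi := psi)) // => y Ry.
  by apply: (can_inj (permK r)); rewrite permKV psiK.
have hom : fas_hom XX R R (a ^ r) (u ^ tau).
  case: iso => hom_r _.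
  have -> : u ^ tau = tau^-1 * u * tau by rewrite conjgE mulgA.
  rewrite (fas_ext XX _ _ (psi := r \o (a \o r^-1))).
    by apply: fas_comp hom_r; apply: fas_comp homV hom_a.
  by move=> y _; rewrite conjgE !permM.
rewrite hom andbT inE; apply/andP; split; last first.
  by apply/morphicP; apply: fas_hom_morph hom.
apply/subsetP=> y; rewrite inE; apply: contraR => notRy.
rewrite -[y](permKV r) permJ (@out_perm _ P a) //.
  by case/setIdP: Aut_a.
by apply: contra notRy => Px; rewrite -(permKV r y) -imR imset_f.
Qed.

Lemma inv_onE P Q phi sigma x :
  fas_hom XX P Q phi sigma -> x \in P -> inv_on P phi (phi x) = x.
Proof.
move=> hom Px; rewrite /inv_on; case: pickP => [y /andP[Py /eqP]|/(_ x)] /=.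
  exact: (fas_hom_inj hom).
by rewrite Px eqxx.
Qed.

(** The extender is the whole normalizer as soon as transport along the
    isomorphism carries [AutSX l P] into [AutSX l R]. *)
Lemma norm_sub_extender P R (r : {perm S}) tau :
  is_iso P R r tau -> AutSX l P :^ (r, tau) \subset AutSX l R ->
  'N(P) \subset extender l P R r tau.
Proof.
move=> iso /subsetP sJ; apply/subsetP=> n Nn; rewrite inE Nn /=.
apply/existsP; exists ((lconj_aut P n, ell l n) ^ (r, tau)).
rewrite sJ /=; last by rewrite memJ_conjg; apply/imsetP; exists n.
rewrite eqxx andbT; apply/forall_inP=> y.
rewrite -(fas_iso_image iso) => /imsetP[x Px ->]; case: iso => hom _.
by rewrite permJ (inv_onE hom) // lconj_autE.
Qed.

Variables (p : nat) (pS : p.-group [set: S]) (satXX : saturated XX p).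

(** Sylow's theorem in the automorphism group of [R] provides the correction
    after which the isomorphism is defined on the whole normalizer. *)
Lemma extends_to_normalizer P R phi sigma :
  fully_normalized XX R -> is_iso P R phi sigma ->
  exists psi tau, fas_hom XX 'N(P)%G [set: S]%G psi tau /\ is_iso P R psi tau.
Proof.
move=> fnR iso; have [_ sylR _] := sat_Sylow satXX fnR.
have [r rE] : exists r : {perm S}, {in P, r =1 phi}.
  by apply: perm_extending; case: iso => /fas_hom_inj.
have iso_r : is_iso P R r sigma by apply: fas_iso_ext iso => x /rE.
have [||[a u] Aau sub] :=
  Sylow_Jsub (Q := (AutSX_group l P :^ (r, sigma))%G) sylR.
- apply/subsetP=> _ /imsetP[b Ab ->].
  by apply: aut_fas_conj iso_r _; apply: (subsetP (AutSX_sub P)).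
- by rewrite pgroupJ AutSX_pgroup.
have iso_ra : is_iso P R (r * a) (sigma * u).
  apply: (@fas_iso_ext _ _ (a \o r)) => [x _|]; first by rewrite permM.
  apply: fas_iso_comp iso_r _; apply/fas_isoP.
  move: Aau; rewrite in_aut_fas => /andP[Aut_a hom_a]; split=> //=.
  by rewrite -[RHS](im_autm Aut_a) morphimEdom; apply: eq_imset => x.
have subN : 'N(P) \subset extender l P R (r * a) (sigma * u).
  by apply: norm_sub_extender iso_ra _; rewrite -conjsgM in sub.
have xcR : fully_Xcentralized XX R.
  by have [_ /(sat_fully_centralized satXX)] := sat_fully_normalized satXX fnR.
have [psi hom psiE] := sat_extension satXX xcR iso_ra.
exists psi, (sigma * u); split; last by apply: fas_iso_ext iso_ra => x /psiE.
by apply: fas_restrict hom; apply: subset_trans subN (subset_gen _).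
Qed.

(** * Decomposable isomorphisms *)

(** The last clause of a step lets the composite be represented by any function
    with the right values on [P]. *)
Inductive decomposable P : {group S} -> (S -> S) -> {perm X} -> Prop :=
| Decomposable_id phi : {in P, phi =1 id} -> decomposable P P phi 1
| Decomposable_step Q R (T : {group S}) phi psi chi sigma tau of
    decomposable P Q phi sigma & Q \subset T & R \subset T
    & fas_hom XX T T psi tau & psi @: Q = R & {in P, chi =1 psi \o phi} :
  decomposable P R chi (sigma * tau).

Lemma decomposable_ext P Q phi psi sigma : {in P, phi =1 psi} ->
  decomposable P Q phi sigma -> decomposable P Q psi sigma.
Proof.
move=> eq_phi dec; case: dec eq_phi => [phi0 phi0E | ] => [eq_phi|].
  by apply: Decomposable_id => x Px; rewrite -eq_phi ?phi0E.
move=> Q0 R T phi0 psi0 chi sigma0 tau dec sQT sRT hom im chiE eq_phi.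
by apply: Decomposable_step dec sQT sRT hom im _ => x Px; rewrite -eq_phi ?chiE.
Qed.

Lemma decomposable_restrict_aut P Q R phi sigma :
  P \subset R -> Q \subset R -> fas_hom XX R R phi sigma -> phi @: P = Q ->
  decomposable P Q phi sigma.
Proof.
move=> sPR sQR hom im; rewrite -[sigma]mul1g.
by apply: (Decomposable_step (Decomposable_id (phi := id) _) sPR sQR hom im).
Qed.

Lemma decomposable_iso P Q phi sigma :
  decomposable P Q phi sigma -> is_iso P Q phi sigma.
Proof.
elim=> {Q phi sigma} [phi phiE|].
  apply: (@fas_iso_ext _ _ id) => [x /phiE //|]; apply/fas_isoP.
  by rewrite imset_id; split=> //; apply: fas_incl.
move=> Q R T phi psi chi sigma tau _ iso sQT sRT hom im chiE.
apply: (@fas_iso_ext _ _ (psi \o phi)) => [x /chiE //|].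
apply: fas_iso_comp iso _.
have [R' imR' isoR'] := fas_corestrict (fas_restrict sQT hom).
by have <- : R' = R by apply: val_inj; rewrite /= imR'.
Qed.

Lemma decomposable_comp P Q R phi psi sigma tau :
  decomposable P Q phi sigma -> decomposable Q R psi tau ->
  decomposable P R (psi \o phi) (sigma * tau).
Proof.
move=> dec1 dec2.
have imQ x : x \in P -> phi x \in Q.
  by rewrite -(fas_iso_image (decomposable_iso dec1)); apply: imset_f.
elim: dec2 => {R psi tau} [psi psiE|].
  by rewrite mulg1; apply: decomposable_ext dec1 => x Px; rewrite /= psiE ?imQ.
move=> R R' T psi psi' chi tau tau' _ IH sRT sRT' hom im chiE.
rewrite mulgA; apply: Decomposable_step IH sRT sRT' hom im _ => x Px.
by rewrite /= chiE ?imQ.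
Qed.

Lemma decomposable_inv P Q phi sigma : decomposable P Q phi sigma ->
  exists2 psi, decomposable Q P psi sigma^-1 & {in P, cancel phi psi}.
Proof.
move=> dec; have := fas_iso_image (decomposable_iso dec).
elim: dec => {Q phi sigma}.
  move=> phi phiE _; exists id => [|x Px]; last by rewrite phiE.
  by rewrite invg1; apply: Decomposable_id.
move=> Q R T phi psi chi sigma tau /decomposable_iso/fas_iso_image imQ.
move=> /(_ imQ)[phi' dec' phiK] sQT sRT hom im chiE _.
(* An injective endomorphism of [T] is onto, hence invertible in the system. *)
have [psi' [isoV psiK _]] : exists psi', [/\ is_iso T T psi' tau^-1,
    {in T, cancel psi psi'} & {in T, cancel psi' psi}].
  apply: fas_iso_inv; apply/fas_isoP; split=> //; apply/eqP.
  rewrite eqEcard (fas_hom_sub hom) card_in_imset ?leqnn //.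
  exact: fas_hom_inj hom.
exists (phi' \o psi') => [|x Px].
  rewrite invMg; apply: decomposable_comp dec'.
  case: isoV => homV _; apply: (decomposable_restrict_aut sRT sQT homV).
  rewrite -im -imset_comp -[RHS]imset_id; apply: eq_in_imset => x Qx /=.
  by rewrite psiK // (subsetP sQT).
by rewrite /= chiE //= psiK ?phiK // (subsetP sQT) // -imQ imset_f.
Qed.

Lemma decomposable_restrict P P' Q Q' phi sigma :
  decomposable P' Q' phi sigma -> P \subset P' -> phi @: P = Q ->
  decomposable P Q phi sigma.
Proof.
move=> dec sPP'; elim: dec Q => {Q' phi sigma} [phi phiE Q im|].
  have phiEP : {in P, phi =1 id} by move=> x /(subsetP sPP')/phiE.
  have <- : P = Q.
    by apply: val_inj; rewrite /= -im (eq_in_imset phiEP) imset_id.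
  exact: Decomposable_id.
move=> Q' R' T phi psi chi sigma tau /decomposable_iso/fas_isoP[hom' im'].
move=> IH sQT sRT hom im chiE Q imQ.
have [Q0 imQ0 _] := fas_corestrict (fas_restrict sPP' hom').
have chiEP : {in P, chi =1 psi \o phi} by move=> x /(subsetP sPP')/chiE.
have sQ0 : Q0 \subset Q' by rewrite imQ0 -im' imsetS.
have im0 : psi @: Q0 = Q.
  by rewrite imQ0 -imset_comp -imQ; apply: eq_in_imset => x /chiEP.
have dec0 := IH Q0 (esym imQ0).
apply: (Decomposable_step dec0 (subset_trans sQ0 sQT) _ hom im0 chiEP).
by apply: subset_trans sRT; rewrite -im0 -im imsetS.
Qed.

(** * The fusion theorem *)

Lemma fas_iso_decomposable P Q phi sigma :
  is_iso P Q phi sigma -> decomposable P Q phi sigma.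
Proof.
have [n] := ubnP (#|[set: S]| - #|P|).
elim: n P Q phi sigma => // n IHn P Q phi sigma ltn iso.
have [PT|neqPT] := eqVneq P [set: S]%G.
  have [hom im] := (fas_isoP P Q phi sigma).1 iso.
  have QT : Q = [set: S]%G.
    apply/val_inj/eqP; rewrite eqEcard subsetT /=.
    by rewrite -(fas_iso_card iso) PT.
  rewrite PT QT in hom im *.
  exact: (decomposable_restrict_aut (subxx _) (subxx _) hom).
have [R [chi [rho [fnR isoR]]]] := exists_fully_normalized P.
have ltPT : #|P| < #|[set: S]|.
  apply: proper_card; rewrite properT; apply: contra_neq neqPT => PT.
  exact: val_inj.
have straighten P' psi tau : #|P'| = #|P| -> is_iso P' R psi tau ->
    exists psi' tau', decomposable P' R psi' tau'.
  move=> cardP' /(extends_to_normalizer fnR)[psi' [tau' [homN isoN]]].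
  have ltN : #|P'| < #|'N(P')|.
    have /nilpotent_proper_norm : nilpotent [set: S] := pgroup_nil pS.
    move=> /(_ P'); rewrite setTI => /(_ _)/proper_card-> //.
    rewrite properT; apply: contraTneq ltPT => P'T.
    by rewrite -cardP' -P'T ltnn.
  have [M imM isoM] := fas_corestrict homN.
  exists psi', tau'.
  apply: decomposable_restrict (normG P') (fas_iso_image isoN).
  apply: IHn isoM; rewrite -ltnS; apply: leq_trans ltn.
  by rewrite ltnS ltn_sub2l // -cardP'.
have [psiP [tauP decP]] := straighten P chi rho erefl isoR.
have [phi' [isoV _ _]] := fas_iso_inv iso.
have [psiQ [tauQ decQ]] :=
  straighten Q _ _ (esym (fas_iso_card iso)) (fas_iso_comp isoV isoR).
have [psiP' decP' psiPK] := decomposable_inv decP.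
have [psiQ' decQ' psiQK] := decomposable_inv decQ.
(* Between the two straightenings, [phi] becomes an automorphism of [R]. *)
have isoRR := fas_iso_comp (decomposable_iso decP')
  (fas_iso_comp iso (decomposable_iso decQ)).
have [homRR imRR] := (fas_isoP _ _ _ _).1 isoRR.
have decRR := decomposable_restrict_aut (subxx R) (subxx R) homRR imRR.
have := decomposable_comp decP (decomposable_comp decRR decQ').
rewrite !mulgA mulgV mul1g mulgK; apply: decomposable_ext => x Px /=.
by rewrite psiPK // psiQK // -(fas_iso_image iso) imset_f.
Qed.

(** * Chains indexed by integers *)

Lemma eq_comp_upto (T : Type) (f g : nat -> T -> T) n :
  (forall i, i <= n -> f i = g i) -> comp_upto f n = comp_upto g n.
Proof.
elim: n => //= n IHn eq_fg; rewrite eq_fg // IHn // => i le_in.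
exact: eq_fg (leqW le_in).
Qed.

Lemma decomposable_chain P Q phi sigma : decomposable P Q phi sigma ->
  exists (n : nat) (Ps Rs : nat -> {group S})
    (phis : nat -> S -> S) (sigmas : nat -> {perm X}),
    [/\ Ps 0 = P,
        Ps n = Q,
        forall i : nat, 1 <= i <= n ->
          [/\ Ps i.-1 \subset Rs i, Ps i \subset Rs i,
              fas_hom XX (Rs i) (Rs i) (phis i) (sigmas i)
            & phis i @: Ps i.-1 = Ps i :> {set S}],
        sigma =1 comp_upto (fun i => sigmas i : X -> X) n
      & {in P, phi =1 comp_upto phis n}].
Proof.
elim=> {Q phi sigma} [phi phiE|].
  exists 0, (fun=> P), (fun=> P), (fun=> id), (fun=> 1); split=> //.
    by case.
  by move=> x; rewrite perm1.
move=> Q R T phi psi chi sigma tau _ [n [Ps [Rs [phis [sigmas]]]]].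
move=> [Ps0 Psn steps sigmaE phiE] sQT sRT hom im chiE.
pose upd A (f : nat -> A) (y : A) i := if i <= n then f i else y.
have updE A (f : nat -> A) y i : i <= n -> upd A f y i = f i.
  by rewrite /upd => ->.
have updS A (f : nat -> A) y : upd A f y n.+1 = y by rewrite /upd ltnn.
exists n.+1, (upd _ Ps R), (upd _ Rs T), (upd _ phis psi), (upd _ sigmas tau).
split; rewrite ?updS //.
- case=> // i /=; rewrite ltnS leq_eqVlt => /predU1P[->|lt_in].
    by rewrite !updS updE // Psn.
  by rewrite !updE ?(ltnW lt_in) //; apply: (steps i.+1).
- move=> x; rewrite /= updS permM sigmaE; congr (tau _).
  by rewrite (@eq_comp_upto _ _ (fun i => sigmas i)) // => i le_in; rewrite updE.
- move=> x Px; rewrite /= updS chiE //= phiE //; congr (psi _).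
  by rewrite (@eq_comp_upto _ _ phis) // => i le_in; rewrite updE.
Qed.

End FusionActionSystem.

Theorem theorem2p2p12 (p : nat) (S : finGroupType) (X : finType)
    (l : left_action S X) (XX : fusion_action_system l)
    (p_prime : prime p) (pS : p.-group [set: S]) (satXX : saturated XX p)
    (P Q : {group S}) (phi : S -> S) (sigma : {perm X})
    (XXphi : fas_hom XX P Q phi sigma) :
  exists (n : nat) (Ps Rs : nat -> {group S})
    (phis : nat -> S -> S) (sigmas : nat -> {perm X}),
    [/\ Ps 0 = P,
        Ps n = phi @: P :> {set S},
        forall i : nat, 1 <= i <= n ->
          [/\ Ps i.-1 \subset Rs i, Ps i \subset Rs i,
              fas_hom XX (Rs i) (Rs i) (phis i) (sigmas i)
            & phis i @: Ps i.-1 = Ps i :> {set S}],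
        sigma =1 comp_upto (fun i => sigmas i : X -> X) n
      & {in P, phi =1 comp_upto phis n}].
Proof.
have [R imR iso] := fas_corestrict XXphi.
have [n [Ps [Rs [phis [sigmas [Ps0 Psn steps sigmaE phiE]]]]]] :=
  decomposable_chain (fas_iso_decomposable pS satXX iso).
by exists n, Ps, Rs, phis, sigmas; split=> //; rewrite Psn.
Qed.
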